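(* Let $K\ge2$ and suppose the loss vectors $(\ell_t^1,\dots,\ell_t^K)\in[0,1]^K$, $t=1,2,\dots$, are drawn i.i.d. across rounds, with means $\mathbb E[\ell_t^a]=\mu_a$, an optimal arm $a^\star$ with $\mu_{a^\star}\le\mu_a$ for all $a$, gaps $\Delta_a=\mu_a-\mu_{a^\star}$, and effective loss range $\varepsilon$. Then for every $T\ge1$ the expected regret of SODA satisfies \[ \mathcal{R}_T\le\sum_{a:\Delta_a>0}\left[\left(\frac{16K^3}{\ln K}+16K^2\right)\frac{\varepsilon^2}{\Delta_a}+4K^2+\frac{\Delta_a}{K}\right]. \]
   Context: Setting: $K$ arms, $[K]=\{1,\dots,K\}$. In each round $t$ the learner picks a primary arm $A_t$, suffers and observes $\ell_t^{A_t}$, and picks a secondary arm $B_t$ (after $A_t$) whose loss $\ell_t^{B_t}$ is observed but not suffered. The effective loss range is the smallest $\varepsilon$ such that $|\ell_t^a-\ell_t^{a'}|\le\varepsilon$ almost surely for all $t$ and $a,a'\in[K]$. The expected regret is $\mathcal{R}_T=\mathbb{E}[\sum_{t=1}^T\ell_t^{A_t}]-\min_{a}\mathbb{E}[\sum_{t=1}^T\ell_t^a]$, which in this stochastic setting equals $\sum_{a:\Delta_a>0}\Delta_a\mathbb E[\sum_{t=1}^T\mathbb 1(A_t=a)]$. SODA: for each round $t$, draw $A_t\sim \mathbf p_t$, then draw $B_t$ uniformly from $[K]\setminus\{A_t\}$, observe $\ell_t^{A_t},\ell_t^{B_t}$, and set $\widetilde{\Delta\ell}_t^a=(K-1)\mathbb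 1(B_t=a)(\ell_t^{B_t}-\ell_t^{A_t})$ for all $a$. Let $D_t(a)=\sum_{s=1}^t\widetilde{\Delta\ell}_s^a$, $S_t(a)=\sum_{s=1}^t(\widetilde{\Delta\ell}_s^a)^2$, $D_0=S_0=0$, $\eta_t=\min\{\sqrt{\ln K/(\max_a S_{t-1}(a)+(K-1)^2)},\,1/(2(K-1))\}$ and $p_t^a=\exp(-\eta_tD_{t-1}(a)-\eta_t^2S_{t-1}(a))/\sum_{b}\exp(-\eta_tD_{t-1}(b)-\eta_t^2S_{t-1}(b))$. *)

(* Defs.v *)
From HB Require Import structures.
From mathcomp Require Import all_boot all_order all_algebra.
From mathcomp Require Import all_classical all_reals all_analysis.
Set Implicit Arguments. Unset Strict Implicit. Unset Printing Implicit Defensive.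
Import Order.TTheory GRing.Theory Num.Theory.
Import numFieldNormedType.Exports.
Local Open Scope classical_set_scope.
Local Open Scope ring_scope.

(* One round: a sample point w of the probability space (Omega, P) produces
   the loss vector (ell a w)_{a in [K]}.  Rounds are i.i.d. copies. *)

Section SODA.
Variable R : realType.
Variable K : nat.

Definition soda_eta (S : 'I_K -> R) : R :=
  Num.min (Num.sqrt (ln (K%:R) / (\big[Num.max/0]_(a < K) S a + (K%:R - 1) ^+ 2)))
          (1 / (2 * (K%:R - 1))).

Definition soda_p (D S : 'I_K -> R) (a : 'I_K) : R :=
  let eta := soda_eta S in
  expR (- eta * D a - eta ^+ 2 * S a) /
  \sum_(b < K) expR (- eta * D b - eta ^+ 2 * S b).

(* importance-weighted loss difference estimate for primary A, secondary B *)
Definition soda_dl (A B : 'I_K) (l : 'I_K -> R) (a : 'I_K) : R :=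
  (K%:R - 1) * (a == B)%:R * (l B - l A).

Definition soda_updD (D : 'I_K -> R) A B l : 'I_K -> R :=
  fun a => D a + soda_dl A B l a.
Definition soda_updS (S : 'I_K -> R) A B l : 'I_K -> R :=
  fun a => S a + (soda_dl A B l a) ^+ 2.

Variables (d : measure_display) (Omega : measurableType d).
Variable P : probability Omega R.
Variable ell : 'I_K -> Omega -> R.

(* soda_loss n D S = expected cumulative suffered loss of SODA over n rounds
   started in state (D, S), losses of each round drawn independently from P,
   A ~ p, B uniform on [K] \ {A}. *)
Fixpoint soda_loss (n : nat) (D S : 'I_K -> R) : R :=
  match n with
  | 0 => 0
  | n'.+1 =>
    \int[P]_w (\sum_(A < K) soda_p D S A *
       \sum_(B < K | B != A) (K%:R - 1)^-1 *
          (ell A w + soda_loss n' (soda_updD D A B (fun b => ell b w))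
                                   (soda_updS S A B (fun b => ell b w))))
  end.

Definition mean (a : 'I_K) : R := \int[P]_w ell a w.

(* expected regret: E[sum_t l_t^{A_t}] - min_a E[sum_t l_t^a]; a0 is any arm
   (only used as the seed of the iterated minimum) *)
Definition soda_regret (T : nat) (a0 : 'I_K) : R :=
  soda_loss T (fun=> 0) (fun=> 0) -
  \big[Num.min/ (T%:R * mean a0)]_(a < K) (T%:R * mean a).

Definition eff_range : R :=
  inf [set e : R | {ae P, forall w, forall a b : 'I_K, `|ell a w - ell b w| <= e}].

End SODA.

(* Main.v *)
(** The regret is [\sum_a Delta a * E (\sum_t p_t a)]. In a round with state
    [(D, S)] compare the arm [a] with the optimal arm [b]. If [D a - D b] is at
    least half of its expected value [t * Delta a], then
    [p_t a <= K * expR (- eta_t * t * Delta a / 2)], because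
    [eta_t ^+ 2 * S b <= ln K]; the learning rate is of order
    [sqrt (ln K / t) / (K * eps)], unless it is at least [1 / (2 * (K - 1))], and
    the sum over [t] is of order [K ^+ 3 * eps ^+ 2 / (ln K * Delta a ^+ 2)].
    Otherwise [1 <= expR (lam * (t * Delta a / 2 - (D a - D b)))], and the
    expectation of the right-hand side decays geometrically in [t]: the
    increments of [D a - D b] are bounded by [(K - 1) * eps] and, whatever the
    primary arm, have conditional mean [Delta a]. *)
Require Import Defs.
From HB Require Import structures.
From mathcomp Require Import all_boot all_order all_algebra.
From mathcomp Require Import all_classical all_reals all_analysis.
From mathcomp Require Import measurable_realfun.
From mathcomp Require Import ring lra.
Set Implicit Arguments. Unset Strict Implicit. Unset Printing Implicit Defensive.
Import Order.TTheory GRing.Theory Num.Theory.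
Import numFieldNormedType.Exports.
Local Open Scope classical_set_scope.
Local Open Scope ring_scope.

(** * Inequalities and series bounds for the exponential *)

Lemma expR_ge_quad (R : realType) (x : R) :
  0 <= x -> 1 + x + x ^+ 2 / 2 <= expR x.
Proof.
move=> x0.
have -> : 1 + x + x ^+ 2 / 2 = series (exp_coeff x) 3.
  by rewrite /series /= !big_mkord 3!big_ord_recr big_ord0 /= add0r
    /exp_coeff /= !divr1 expr0 expr1.
apply: nondecreasing_cvgn_le; last exact: is_cvg_series_exp_coeff.
by apply: nondecreasing_series => n _ _; exact: exp_coeff_ge0.
Qed.

(** Squaring [expR (x / 2) <= (1 - x / 2)^-1] leaves [1 <= (1 + x + x ^+ 2) * (1 - x / 2) ^+ 2],
    whose excess over 1 is [x ^+ 2 / 4 * (1 - 3 * x + x ^+ 2)]. *)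
Lemma expR_le_quad (R : realType) (x : R) :
  `|x| <= 4^-1 -> expR x <= 1 + x + x ^+ 2.
Proof.
rewrite ler_norml => /andP[x1 x2].
have y0 : 0 < 1 - x / 2 by lra.
have h : expR (x / 2) <= (1 - x / 2)^-1.
  rewrite -[x / 2 in leLHS]opprK expRN lef_pV2 ?posrE ?expR_gt0 //.
  exact: expR_ge1Dx.
have -> : expR x = expR (x / 2) ^+ 2 by rewrite -expRM_natl; congr expR; lra.
apply: (le_trans (y := (1 - x / 2)^-1 ^+ 2)).
  by rewrite ler_sqr ?nnegrE ?expR_ge0 // invr_ge0 ltW.
rewrite exprVn -[leLHS]mul1r ler_pdivrMr ?exprn_gt0 //.
by nra.
Qed.

(** Telescoping: by [1 + c <= expR c], each term times [c] is at most a decrement of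
    [expR (- (c * i))]. *)
Lemma sum_expRN_le (R : realType) (c : R) (n : nat) :
  0 < c -> \sum_(i < n) expR (- (c * i.+1%:R)) <= c^-1.
Proof.
move=> c0.
have : \sum_(i < n) expR (- (c * i.+1%:R)) <= (1 - expR (- (c * n%:R))) / c.
  elim: n => [|n IH]; first by rewrite big_ord0 mulr0 oppr0 expR0 subrr mul0r.
  rewrite big_ord_recr /=; apply: (le_trans (lerD IH (lexx _))).
  rewrite ler_pdivlMr // mulrDl divfK ?gt_eqF //.
  have -> : expR (- (c * n%:R)) = expR (- (c * n.+1%:R)) * expR c.
    by rewrite -expRD; congr expR; rewrite -natr1; lra.
  have := expR_ge1Dx c; have := expR_gt0 (- (c * n.+1%:R)).
  set a := expR (- _); set b := expR c; nra.
move/le_trans; apply.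
by rewrite ler_pdivrMr // mulVf ?gt_eqF // gerBl expR_ge0.
Qed.

(* The terms are dominated by the increments of [- (2 / c^2) (1 + u) e^-u] at
   [u = c sqrt i], an antiderivative of [e^-(c sqrt x)]. *)
Lemma sum_expRN_sqrt_le (R : realType) (c : R) (n : nat) :
  0 < c -> \sum_(i < n) expR (- (c * Num.sqrt i.+1%:R)) <= 2 / c ^+ 2.
Proof.
move=> c0.
pose F (m : nat) : R := (1 + c * Num.sqrt m%:R) * expR (- (c * Num.sqrt m%:R)).
have : \sum_(i < n) expR (- (c * Num.sqrt i.+1%:R)) <= (1 - F n) * (2 / c ^+ 2).
  elim: n => [|n IH].
    by rewrite big_ord0 /F sqrtr0 mulr0 oppr0 expR0 addr0 mulr1 subrr mul0r.
  rewrite big_ord_recr /=; apply: (le_trans (lerD IH (lexx _))).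
  rewrite [leRHS]mulrA ler_pdivlMr ?exprn_gt0 // mulrDl.
  rewrite -[X in X + _]mulrA divfK ?gt_eqF ?exprn_gt0 //.
  rewrite /F; set u := c * Num.sqrt n%:R; set v := c * Num.sqrt n.+1%:R.
  have u0 : 0 <= u by rewrite mulr_ge0 // ltW.
  have uv : u <= v by rewrite ler_wpM2l ?(ltW c0) // ler_wsqrtr // ler_nat.
  have d : c ^+ 2 = v ^+ 2 - u ^+ 2.
    by rewrite !exprMn !sqr_sqrtr // -natr1; ring.
  have -> : expR (- u) = expR (- v) * expR (v - u).
    by rewrite -expRD; congr expR; ring.
  rewrite d.
  have w0 := expR_gt0 (- v).
  (* The quadratic term matters: [u * (v - u) + (v - u) ^+ 2 / 2] is exactly
     [(v ^+ 2 - u ^+ 2) / 2], that is [c ^+ 2 / 2]. *)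
  have : 1 + (v - u) + (v - u) ^+ 2 / 2 <= expR (v - u).
    by apply: expR_ge_quad; rewrite subr_ge0.
  set e := expR (v - u) => he.
  have h1 : (1 + u) * (1 + (v - u) + (v - u) ^+ 2 / 2) <= (1 + u) * e.
    by rewrite ler_wpM2l // addr_ge0.
  have h2 : 1 + v + (v ^+ 2 - u ^+ 2) / 2 <= (1 + u) * e.
    apply: le_trans h1.
    have : 0 <= u * (v - u) ^+ 2 by rewrite mulr_ge0 // sqr_ge0.
    by nra.
  have := ler_wpM2l (ltW w0) h2.
  set W := expR (- v); nra.
move/le_trans; apply; rewrite ger_pMl ?divr_gt0 ?exprn_gt0 //.
by rewrite gerBl /F mulr_ge0 ?expR_ge0 // addr_ge0 // mulr_ge0 // ltW.
Qed.

Lemma ln_nat_ge_half (R : realType) (K : nat) : (2 <= K)%N -> 2^-1 <= ln K%:R :> R.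
Proof.
move=> K2; rewrite -[leLHS]expRK ler_ln ?posrE ?expR_gt0 ?ltr0n ?(ltnW K2) //.
apply: (le_trans (y := 2)); last by rewrite ler_nat.
rewrite -[leLHS]invrK -expRN -[leRHS]invrK lef_pV2 ?posrE ?expR_gt0 //.
by have := expR_ge1Dx (- 2^-1 : R); lra.
Qed.

(** * The sampling distribution of SODA and its measurability *)

Lemma soda_den_gt0 (R : realType) (K : nat) (D S : 'I_K -> R) (A : 'I_K) :
  0 < \sum_(b < K) expR (- soda_eta S * D b - soda_eta S ^+ 2 * S b).
Proof.
by rewrite (bigD1 A) //= ltr_pwDl ?expR_gt0 // sumr_ge0.
Qed.

Lemma soda_p_ge0 (R : realType) (K : nat) (D S : 'I_K -> R) (A : 'I_K) :
  0 <= soda_p D S A.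
Proof. by rewrite divr_ge0 ?expR_ge0 // ltW // soda_den_gt0. Qed.

Lemma soda_p_sum (R : realType) (K : nat) (D S : 'I_K -> R) :
  (0 < K)%N -> \sum_(A < K) soda_p D S A = 1.
Proof.
by move=> K0; rewrite -mulr_suml divff // gt_eqF // (soda_den_gt0 _ _ (Ordinal K0)).
Qed.

Lemma soda_p_le1 (R : realType) (K : nat) (D S : 'I_K -> R) (A : 'I_K) :
  soda_p D S A <= 1.
Proof.
rewrite -(soda_p_sum D S (leq_ltn_trans (leq0n A) (ltn_ord A))).
by rewrite (bigD1 A) //= lerDl sumr_ge0 // => b _; exact: soda_p_ge0.
Qed.

Lemma bigmaxr_ge0 (R : realType) (K : nat) (S : 'I_K -> R) :
  0 <= \big[Num.max/0]_(a < K) S a.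
Proof. exact: bigmax_ge_id. Qed.

Lemma measurable_bigmaxr (R : realType) (d : measure_display)
    (X : measurableType d) (I : Type) (s : seq I) (f : I -> X -> R) :
  (forall i, measurable_fun setT (f i)) ->
  measurable_fun setT (fun x => \big[Num.max/0]_(i <- s) f i x).
Proof.
move=> mf; elim: s => [|i s IH].
  under eq_fun do rewrite big_nil; exact: measurable_cst.
by under eq_fun do rewrite big_cons; exact: measurable_maxr.
Qed.

Lemma measurable_soda_eta (R : realType) (K : nat) (d : measure_display)
    (X : measurableType d) (S : 'I_K -> X -> R) : (2 <= K)%N ->
  (forall a, measurable_fun setT (S a)) ->
  measurable_fun setT (fun x => soda_eta (S ^~ x)).
Proof.
move=> K2 mS; apply: measurable_minr => //.
pose m x := \big[Num.max/0]_(a < K) S a x + (K%:R - 1) ^+ 2.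
have m0 x : 0 <= m x by rewrite addr_ge0 ?bigmaxr_ge0 // sqr_ge0.
(* Square root and inverse become real powers of nonnegative quantities, which are measurable in the
   base. *)
under eq_fun => x.
  rewrite -powR12_sqrt; last first.
    by rewrite divr_ge0 ?(m0 x) // ltW // (lt_le_trans _ (ln_nat_ge_half R K2)).
  rewrite -[X in _ / X](powRr1 (m0 x)) -powRN.
  over.
apply: (measurableT_comp (measurable_powR _)).
apply: measurable_funM => //.
apply: (measurableT_comp (measurable_powR _)).
by apply: measurable_funD => //; exact: measurable_bigmaxr.
Qed.

Lemma measurable_soda_p (R : realType) (K : nat) (d : measure_display)
    (X : measurableType d) (D S : 'I_K -> X -> R) (A : 'I_K) : (2 <= K)%N ->
  (forall a, measurable_fun setT (D a)) ->
  (forall a, measurable_fun setT (S a)) ->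
  measurable_fun setT (fun x => soda_p (D ^~ x) (S ^~ x) A).
Proof.
move=> K2 mD mS; have meta := measurable_soda_eta K2 mS.
have mw b : measurable_fun setT (fun x =>
    expR (- soda_eta (S ^~ x) * D b x - soda_eta (S ^~ x) ^+ 2 * S b x)).
  apply: measurableT_comp => //; apply: measurable_funB.
    by apply: measurable_funM => //; exact: measurableT_comp.
  by apply: measurable_funM => //; exact: measurable_funX.
under eq_fun => x.
  rewrite /soda_p -[X in _ / X](powRr1 (ltW (soda_den_gt0 (D ^~ x) (S ^~ x) A))).
  rewrite -powRN.
  over.
apply: measurable_funM => //.
apply: (measurableT_comp (measurable_powR _)).
exact: measurable_sum.
Qed.


(** * Means over the draws of the two arms, with the loss vector held fixed *)

Definition round_mean (R : realType) (K : nat) (D S : 'I_K -> R)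
    (f : 'I_K -> 'I_K -> R) : R :=
  \sum_(A < K) soda_p D S A * \sum_(B < K | B != A) (K%:R - 1)^-1 * f A B.

Lemma secondary_mean_cst (R : realType) (K : nat) (A : 'I_K) (c : R) : (2 <= K)%N ->
  \sum_(B < K | B != A) (K%:R - 1)^-1 * c = c.
Proof.
move=> K2; have K1 : K%:R - 1 = K.-1%:R :> R.
  by rewrite -[in LHS](ltn_predK K2) -natr1 addrK.
rewrite -mulr_sumr K1 sumr_const cardC1 card_ord -[c *+ _]mulr_natl mulKf //.
by rewrite pnatr_eq0 -lt0n -ltnS prednK // ltnW.
Qed.

Lemma round_mean_cst (R : realType) (K : nat) (D S : 'I_K -> R) (c : R) :
  (2 <= K)%N -> round_mean D S (fun _ _ => c) = c.
Proof.
move=> K2; rewrite /round_mean.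
under eq_bigr do rewrite secondary_mean_cst //.
by rewrite -mulr_suml soda_p_sum ?mul1r // ltnW.
Qed.

Lemma natrB1_gt0 (R : realType) (K : nat) : (2 <= K)%N -> 0 < K%:R - 1 :> R.
Proof. by move=> K2; rewrite subr_gt0 ltr1n. Qed.

Lemma le_round_mean (R : realType) (K : nat) (D S : 'I_K -> R)
    (f g : 'I_K -> 'I_K -> R) : (2 <= K)%N ->
  (forall A B, B != A -> f A B <= g A B) -> round_mean D S f <= round_mean D S g.
Proof.
move=> K2 fg; apply: ler_sum => A _; apply: ler_wpM2l; first exact: soda_p_ge0.
apply: ler_sum => B BA; apply: ler_wpM2l; last exact: fg.
by rewrite invr_ge0 ltW // natrB1_gt0.
Qed.

Lemma measurable_round_mean (R : realType) (K : nat) (d : measure_display)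
    (X : measurableType d) (D S : 'I_K -> X -> R) (f : 'I_K -> 'I_K -> X -> R) :
  (2 <= K)%N ->
  (forall a, measurable_fun setT (D a)) ->
  (forall a, measurable_fun setT (S a)) ->
  (forall A B, measurable_fun setT (f A B)) ->
  measurable_fun setT
    (fun x => round_mean (D ^~ x) (S ^~ x) (fun A B => f A B x)).
Proof.
move=> K2 mD mS mf; apply: measurable_sum => A.
apply: measurable_funM; first exact: measurable_soda_p.
under eq_fun do rewrite big_mkcond.
apply: measurable_sum => B; case: (B != A) => //.
exact: measurable_funM.
Qed.

(** * Integrals of real functions under a probability *)

Section probability_integral.
Context {R : realType} {d : measure_display} {Omega : measurableType d}.
Variable P : probability Omega R.

Lemma bounded_integrable (f : Omega -> R) (M : R) :
  measurable_fun setT f -> (forall w, `|f w| <= M) ->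
  P.-integrable setT (EFin \o f).
Proof.
move=> mf fM; apply: measurable_bounded_integrable => //.
  by rewrite ltey_eq fin_num_measure.
exists M; split; first exact: num_real.
by move=> x Mx w _ /=; rewrite (le_trans (fM w)) // ltW.
Qed.

(** The function [f \max g] dominates [f] everywhere and equals [g] almost everywhere, so pointwise
    monotonicity applies to it. *)
Lemma ae_le_Rintegral (f g : Omega -> R) :
  P.-integrable setT (EFin \o f) -> P.-integrable setT (EFin \o g) ->
  {ae P, forall w, f w <= g w} -> \int[P]_w f w <= \int[P]_w g w.
Proof.
move=> intf intg fg.
have mf := measurable_int _ intf; have mg := measurable_int _ intg.
have mh : measurable_fun setT (f \max g).
  by apply: measurable_maxr; exact/measurable_EFinP.
have inth : P.-integrable setT (EFin \o (f \max g)).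
  apply: (@le_integrable _ _ _ _ _ _ _ (fun w => (`|f w| + `|g w|)%:E)) => //=.
  - exact/measurable_EFinP.
  - move=> w _; rewrite lee_fin [leRHS]ger0_norm ?addr_ge0 //.
    by case: (leP (f w) (g w)) => _; rewrite ?lerDl ?lerDr.
  - exact: (integrableD measurableT (integrable_norm intf) (integrable_norm intg)).
rewrite (_ : \int[P]_w g w = \int[P]_w (f \max g) w).
  by apply: le_Rintegral => // w _; rewrite le_max lexx.
congr fine; apply: ae_eq_integral => //; first exact/measurable_EFinP.
by apply: filterS fg => w fgw _ /=; rewrite (max_idPr fgw).
Qed.

(** Linearity of the integral requires integrability, so the two are carried together through sums
    and multiples. *)
Definition has_mean (f : Omega -> R) (m : R) :=
  P.-integrable setT (EFin \o f) /\ \int[P]_w f w = m.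

Lemma has_mean_cst (c : R) : has_mean (fun=> c) c.
Proof.
split; first by apply: (bounded_integrable (M := `|c|)).
rewrite Rintegral_cst // (_ : fine _ = 1) ?mulr1 //.
by rewrite -[1]/(fine 1) -(probability_setT P).
Qed.

Lemma has_meanD (f g : Omega -> R) (m n : R) :
  has_mean f m -> has_mean g n -> has_mean (fun w => f w + g w) (m + n).
Proof.
move=> [fi <-] [gi <-]; split; first exact: (integrableD measurableT fi gi).
exact: RintegralD.
Qed.

Lemma has_meanZ (f : Omega -> R) (m c : R) :
  has_mean f m -> has_mean (fun w => c * f w) (c * m).
Proof.
move=> [fi <-]; split; first exact: (integrableZl measurableT c fi).
exact: RintegralZl.
Qed.

Lemma has_mean_sum (I : Type) (s : seq I) (Q : pred I) (f : I -> Omega -> R)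
    (m : I -> R) :
  (forall i, Q i -> has_mean (f i) (m i)) ->
  has_mean (fun w => \sum_(i <- s | Q i) f i w) (\sum_(i <- s | Q i) m i).
Proof.
move=> fm; elim: s => [|i s IH].
  under [X in has_mean X _]funext do rewrite big_nil.
  by rewrite big_nil; exact: has_mean_cst.
under [X in has_mean X _]funext do rewrite big_cons.
by rewrite big_cons; case: ifP => // Qi; apply: has_meanD => //; exact: fm.
Qed.

End probability_integral.

(** * Measurability of the expected loss; the effective range *)

Section soda_value.
Context {R : realType} {K : nat} {d : measure_display} {Omega : measurableType d}.
Variables (P : probability Omega R) (ell : 'I_K -> Omega -> R).
Hypothesis K2 : (2 <= K)%N.
Hypothesis ml : forall a, measurable_fun setT (ell a).
Hypothesis l01 : forall a w, 0 <= ell a w <= 1.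

(** The integrand in the recursive clause of [soda_loss], as a function of the loss vector. *)
Definition soda_round (n : nat) (D S l : 'I_K -> R) : R :=
  round_mean D S (fun A B =>
    l A + soda_loss P ell n (soda_updD D A B l) (soda_updS S A B l)).

Lemma soda_round_bounded (n : nat) (D S l : 'I_K -> R) :
  (forall D S, 0 <= soda_loss P ell n D S <= n%:R) ->
  (forall a, 0 <= l a <= 1) -> 0 <= soda_round n D S l <= n.+1%:R.
Proof.
move=> Hb Hl; have [Hb0 Hb1] : (forall D S, 0 <= soda_loss P ell n D S) /\
    (forall D S, soda_loss P ell n D S <= n%:R).
  by split=> D' S'; case/andP: (Hb D' S').
apply/andP; split.
  rewrite -(round_mean_cst D S 0 K2); apply: le_round_mean => // A B _.
  by have /andP[? _] := Hl A; rewrite addr_ge0.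
rewrite -(round_mean_cst D S n.+1%:R K2); apply: le_round_mean => // A B _.
by have /andP[_ ?] := Hl A; rewrite -nat1r lerD.
Qed.

Lemma measurable_soda_round (n : nat) (d' : measure_display)
    (X : measurableType d') (D S L : 'I_K -> X -> R) :
  (forall D S : 'I_K -> X -> R,
    (forall a, measurable_fun setT (D a)) ->
    (forall a, measurable_fun setT (S a)) ->
    measurable_fun setT (fun x => soda_loss P ell n (D ^~ x) (S ^~ x))) ->
  (forall a, measurable_fun setT (D a)) ->
  (forall a, measurable_fun setT (S a)) ->
  (forall a, measurable_fun setT (L a)) ->
  measurable_fun setT (fun x => soda_round n (D ^~ x) (S ^~ x) (L ^~ x)).
Proof.
move=> Hm mD mS mL.
have mdl A B a : measurable_fun setT (fun x => soda_dl A B (L ^~ x) a).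
  by apply: measurable_funM => //; exact: measurable_funB.
apply: measurable_round_mean => // A B; apply: measurable_funD => //.
apply: (Hm (fun a x => D a x + soda_dl A B (L ^~ x) a)
  (fun a x => S a x + soda_dl A B (L ^~ x) a ^+ 2)) => a.
  exact: measurable_funD.
by apply: measurable_funD => //; exact: measurable_funX.
Qed.

(* The integral of a non-measurable function is a junk value, so the loss has to
   be shown measurable in its state. The state is parametrized by an arbitrary
   space [X] so that the induction can pass to [X * Omega]. *)
Lemma soda_loss_bounded_measurable (n : nat) :
  (forall D S, 0 <= soda_loss P ell n D S <= n%:R) /\
  (forall (d' : measure_display) (X : measurableType d') (D S : 'I_K -> X -> R),
    (forall a, measurable_fun setT (D a)) ->
    (forall a, measurable_fun setT (S a)) ->
    measurable_fun setT (fun x => soda_loss P ell n (D ^~ x) (S ^~ x))).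
Proof.
elim: n => [|n [IHb IHm]].
  by split=> [D S|d' X D S _ _] /=; [rewrite lexx|exact: measurable_cst].
have Fb D S w := soda_round_bounded D S IHb (l01 ^~ w).
split=> [D S|d' X D S mD mS].
  rewrite [soda_loss _ _ _ _ _]/(\int[P]_w soda_round n D S (ell ^~ w)).
  rewrite Rintegral_ge0 /=; last by move=> w _; case/andP: (Fb D S w).
  have [ci cE] := has_mean_cst P n.+1%:R.
  rewrite -[leRHS]cE; apply: ae_le_Rintegral => //; last first.
    by apply: aeW => w; case/andP: (Fb D S w).
  apply: (@bounded_integrable _ _ _ P _ n.+1%:R) => [|w].
    apply: (measurable_soda_round (D := fun a=> cst (D a))
      (S := fun a=> cst (S a)) _ _ _ ml) => // D' S'; exact: IHm.
  by case/andP: (Fb D S w) => ? ?; rewrite ger0_norm.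
(* The loss is a partial integral over [X * Omega], measurable by Tonelli; the boundedness half of
   the induction supplies the nonnegativity. *)
apply: (measurableT_comp (f := @fine R) (g := fubini_F P
  (fun z : X * Omega => (soda_round n (D ^~ z.1) (S ^~ z.1) (ell ^~ z.2))%:E))) => //.
apply: measurable_fun_fubini_tonelli_F; last first.
  by move=> z; rewrite lee_fin; case/andP: (Fb (D ^~ z.1) (S ^~ z.1) z.2).
have h : measurable_fun setT
    (fun z : X * Omega => soda_round n (D ^~ z.1) (S ^~ z.1) (ell ^~ z.2)).
  apply: (measurable_soda_round (D := fun a (z : X * Omega) => D a z.1)
    (S := fun a z => S a z.1) (L := fun a z => ell a z.2)).
  - by move=> D' S'; exact: IHm.
  - by move=> a; exact: measurableT_comp.
  - by move=> a; exact: measurableT_comp.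
  - by move=> a; exact: measurableT_comp.
exact/measurable_EFinP.
Qed.

Lemma soda_round_integrable (n : nat) (D S : 'I_K -> R) :
  P.-integrable setT (EFin \o (fun w => soda_round n D S (ell ^~ w))).
Proof.
have [Hb Hm] := soda_loss_bounded_measurable n.
apply: (@bounded_integrable _ _ _ P _ n.+1%:R) => [|w].
  apply: (measurable_soda_round (D := fun a=> cst (D a))
    (S := fun a=> cst (S a)) _ _ _ ml) => // D' S'; exact: Hm.
by case/andP: (soda_round_bounded D S Hb (l01 ^~ w)) => ? ?; rewrite ger0_norm.
Qed.

Lemma has_mean_loss (a : 'I_K) : has_mean P (ell a) (mean P ell a).
Proof.
split=> //; apply: (@bounded_integrable _ _ _ P _ 1) => // w.
by case/andP: (l01 a w) => ? ?; rewrite ger0_norm.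
Qed.

(** The infimum is attained: the bounds [eff_range P ell + n.+1%:R^-1] hold almost everywhere for
    all [n] at once, by countability, and [n] tends to infinity. *)
Lemma eff_range_ae :
  {ae P, forall w, forall a b, `|ell a w - ell b w| <= eff_range P ell}.
Proof.
set E := [set e : R | {ae P, forall w, forall a b, `|ell a w - ell b w| <= e}].
have E1 : E 1.
  apply: aeW => w a b; rewrite ler_norml.
  by have /andP[? ?] := l01 a w; have /andP[? ?] := l01 b w; lra.
have E0 : lbound E 0.
  move=> e Ee; rewrite leNgt; apply/negP => e0.
  (* A negative [e] is contradicted at almost every point; comparing integrals of constants turns
     this into [- e <= 0]. *)
  have [ci cE] := has_mean_cst P (- e).
  have [oi oE] := has_mean_cst P 0.
  suff : - e <= 0 by rewrite oppr_le0 leNgt e0.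
  rewrite -[leLHS]cE -[leRHS]oE; apply: ae_le_Rintegral => //.
  apply: filterS Ee => w /(_ (Ordinal K2) (Ordinal K2)).
  by rewrite subrr normr0 leNgt e0.
have hE : has_inf E by split; [exists 1|exists 0].
have : {ae P, forall w, forall n : nat, forall a b : 'I_K,
    `|ell a w - ell b w| <= eff_range P ell + n.+1%:R^-1}.
  apply: ae_foralln => n.
  have n0 : 0 < n.+1%:R^-1 :> R by rewrite invr_gt0.
  have [e Ee le] := inf_adherent n0 hE.
  by apply: filterS Ee => w H a b; rewrite (le_trans (H a b)) // ltW.
apply: filterS => w H a b; apply/ler_addgt0Pr => e e0.
have [n ne] := ltr_add_invr e0.
by rewrite (le_trans (H n a b)) // lerD2l ltW // -[ltLHS]add0r.
Qed.

(** Makes [eff_range] positive as soon as some gap is, and keeps the later choice of [lam] small. *)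
Lemma gap_le_eff_range (a b : 'I_K) :
  mean P ell a - mean P ell b <= eff_range P ell.
Proof.
have [ci cE] := has_mean_cst P (eff_range P ell).
have [gi gE] := has_meanD (has_mean_loss a) (has_meanZ (-1) (has_mean_loss b)).
rewrite -[leRHS]cE -[mean P ell b]mul1r -mulNr -gE; apply: ae_le_Rintegral => //.
apply: filterS eff_range_ae => w H; rewrite mulN1r.
exact: le_trans (ler_norm _) (H a b).
Qed.

End soda_value.

(** * One round: learning rate, sampling probabilities, loss estimates *)

Section exploration.
Context {R : realType} {K : nat}.
Hypothesis K2 : (2 <= K)%N.
Notation k := (K%:R - 1 : R).

Lemma soda_eta_ge0 (S : 'I_K -> R) : 0 <= soda_eta S.
Proof.
by rewrite le_min sqrtr_ge0 /= divr_ge0 // mulr_ge0 // ltW // natrB1_gt0.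
Qed.

Lemma soda_eta_sq_le (S : 'I_K -> R) (a : 'I_K) :
  soda_eta S ^+ 2 * S a <= ln K%:R.
Proof.
have L0 : 0 <= ln K%:R :> R by rewrite (le_trans _ (ln_nat_ge_half R K2)).
have k0 : 0 < k := natrB1_gt0 R K2.
set m := \big[Num.max/0]_(a < K) S a.
have m0 : 0 <= m := bigmaxr_ge0 S.
have d0 : 0 < m + k ^+ 2 by rewrite ltr_wpDl // exprn_gt0.
have Sm : S a <= m + k ^+ 2.
  by apply: le_trans (le_bigmax 0 S a) _; rewrite lerDl exprn_ge0 // ltW.
apply: (le_trans (y := soda_eta S ^+ 2 * (m + k ^+ 2))).
  by rewrite ler_wpM2l ?sqr_ge0.
rewrite -ler_pdivlMr //.
rewrite -[leRHS]sqr_sqrtr ?divr_ge0 // ?(ltW d0) //.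
by rewrite ler_sqr ?nnegrE ?soda_eta_ge0 ?sqrtr_ge0 // ge_min lexx.
Qed.

(** If [1 <= t * e ^+ 2], the offset [k ^+ 2] is at most the bound on [S], whence the factor 2.
    Otherwise the denominator is at most [2 * k ^+ 2], and [1 / 2 <= ln K] puts the square root
    above the cap [(2 * k)^-1]. *)
Lemma soda_eta_ge (S : 'I_K -> R) (e : R) (t : nat) : 0 < e -> (0 < t)%N ->
  (forall a, S a <= t%:R * (k ^+ 2 * e ^+ 2)) ->
  Num.min (Num.sqrt (ln K%:R / (2 * (t%:R * (k ^+ 2 * e ^+ 2))))) (2 * k)^-1
    <= soda_eta S.
Proof.
move=> e0 t0 HS.
have L := ln_nat_ge_half R K2.
have L0 : 0 <= ln K%:R :> R by rewrite (le_trans _ L).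
have k0 : 0 < k := natrB1_gt0 R K2.
have t0' : 0 < t%:R :> R by rewrite ltr0n.
have V0 : 0 < t%:R * (k ^+ 2 * e ^+ 2) by rewrite !mulr_gt0 ?exprn_gt0.
have m0 : 0 <= \big[Num.max/0]_(a < K) S a := bigmaxr_ge0 S.
have mV : \big[Num.max/0]_(a < K) S a <= t%:R * (k ^+ 2 * e ^+ 2).
  by apply/bigmax_leP; split=> // ; exact: ltW.
rewrite /soda_eta; set m := \big[_/_]_(_ < _) _ in m0 mV *.
have d0 : 0 < m + k ^+ 2 by rewrite ltr_wpDl // exprn_gt0.
rewrite le_min div1r [X in _ && X]ge_min lexx orbT andbT ge_min.
have [te|te] := leP 1 (t%:R * e ^+ 2).
  apply/orP; left; apply: ler_wsqrtr; apply: ler_wpM2l => //.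
  rewrite lef_pV2 ?posrE // ?mulr_gt0 //.
  have : k ^+ 2 * 1 <= k ^+ 2 * (t%:R * e ^+ 2) by rewrite ler_wpM2l ?sqr_ge0.
  by nra.
apply/orP; right.
rewrite -[leLHS]ger0_norm ?invr_ge0 ?mulr_ge0 // ?(ltW k0) // -sqrtr_sqr.
apply: ler_wsqrtr; rewrite ler_pdivlMr //.
apply: le_trans L; rewrite exprVn ler_pdivrMl ?exprn_gt0 ?mulr_gt0 //.
have : k ^+ 2 * (t%:R * e ^+ 2) <= k ^+ 2 * 1.
  by rewrite ler_wpM2l ?sqr_ge0 // ltW.
by nra.
Qed.

(* Either [D a - D b] has reached half of its drift [t * Delta], and then the
   learning rate makes [a] unlikely, or it has not, and then the second term,
   which is controlled in expectation, is at least [1]. *)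
Lemma soda_p_le (D S : 'I_K -> R) (a b : 'I_K) (e Delta lam : R) (t : nat) :
  0 < e -> 0 < Delta -> 0 <= lam -> (0 < t)%N ->
  (forall a', 0 <= S a' <= t%:R * (k ^+ 2 * e ^+ 2)) ->
  soda_p D S a <=
    K%:R * (expR (- (Num.sqrt (ln K%:R / (2 * (k ^+ 2 * e ^+ 2))) * (Delta / 2)
                      * Num.sqrt t%:R))
            + expR (- (Delta / (4 * k) * t%:R)))
    + expR (lam * (t%:R * Delta / 2)) * expR (- lam * (D a - D b)).
Proof.
move=> e0 De0 lam0 t0 HS.
have k0 : 0 < k := natrB1_gt0 R K2.
have K0 : 0 < K%:R :> R by rewrite ltr0n ltnW.
have HS1 a' : S a' <= t%:R * (k ^+ 2 * e ^+ 2) by case/andP: (HS a').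
have [far|near] := leP (t%:R * Delta / 2) (D a - D b); last first.
  apply: (le_trans (soda_p_le1 _ _ _)).
  rewrite -expRD -[leLHS]add0r lerD //.
  rewrite -[leLHS]expR0 ler_expR.
  by rewrite mulNr -mulrBr mulr_ge0 // subr_ge0 ltW.
rewrite -[leLHS]addr0 lerD ?mulr_ge0 ?expR_ge0 //.
set eta := soda_eta S.
have eta0 : 0 <= eta := soda_eta_ge0 S.
(* The denominator is bounded below by its [b] term; [K] absorbs [expR (eta ^+ 2 * S b)]. *)
apply: (le_trans (y := K%:R * expR (- (eta * (t%:R * Delta / 2))))).
  rewrite /soda_p ler_pdivrMr ?(soda_den_gt0 D S a) //.
  apply: (le_trans (y := K%:R * expR (- (eta * (t%:R * Delta / 2))) *
      expR (- eta * D b - eta ^+ 2 * S b))); last first.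
    rewrite ler_wpM2l ?mulr_ge0 ?expR_ge0 ?(ltW K0) //.
    by rewrite (bigD1 b) //= lerDl sumr_ge0.
  rewrite -[X in X * _ * _](lnK K0) -!expRD ler_expR.
  have /andP[Sa _] := HS a.
  have := soda_eta_sq_le S b; rewrite -/eta.
  have : 0 <= eta ^+ 2 * S a by rewrite mulr_ge0 ?sqr_ge0.
  have := ler_wpM2l eta0 far.
  by rewrite mulrBr; lra.
rewrite ler_wpM2l ?(ltW K0) //.
have tD0 : 0 <= t%:R * Delta / 2 by rewrite !mulr_ge0 // ltW.
(* Each candidate for the minimum yields one of the two exponentials; the other is discarded as
   nonnegative. *)
have := soda_eta_ge e0 t0 HS1; rewrite -/eta ge_min => /orP[le|le].
  rewrite -[leLHS]addr0 lerD ?expR_ge0 // ler_expR lerN2.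
  apply: le_trans (ler_wpM2r tD0 le).
  have t00 : 0 < t%:R :> R by rewrite ltr0n.
  set V := k ^+ 2 * e ^+ 2.
  have V0 : 0 < V by rewrite mulr_gt0 ?exprn_gt0.
  have L0 : 0 <= ln K%:R :> R by rewrite (le_trans _ (ln_nat_ge_half R K2)).
  have -> : ln K%:R / (2 * (t%:R * V)) = ln K%:R / (2 * V) / t%:R.
    by field; rewrite !gt_eqF.
  have Q0 : 0 <= ln K%:R / (2 * V) by rewrite divr_ge0 // mulr_ge0 // ltW.
  rewrite [in leRHS](sqrtrM _ Q0) sqrtrV ?ler0n //.
  have st : 0 < Num.sqrt t%:R :> R by rewrite sqrtr_gt0.
  rewrite -[X in _ <= _ * (X * Delta / 2)](sqr_sqrtr (ler0n R t)).
  rewrite le_eqVlt; apply/orP; left; apply/eqP.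
  by field; rewrite gt_eqF.
rewrite -[leLHS]add0r lerD ?expR_ge0 // ler_expR lerN2.
apply: le_trans (ler_wpM2r tD0 le).
rewrite le_eqVlt; apply/orP; left; apply/eqP.
by field; rewrite gt_eqF.
Qed.

(** Handles the first round, where [soda_p_le] does not apply. *)
Lemma soda_p0 (D S : 'I_K -> R) (a : 'I_K) :
  (forall b, D b = 0) -> (forall b, S b = 0) -> soda_p D S a = K%:R^-1.
Proof.
move=> D0 S0; rewrite /soda_p D0 S0 !mulr0 subrr expR0.
under eq_bigr do rewrite D0 S0 !mulr0 subrr expR0.
by rewrite sumr_const card_ord div1r.
Qed.

Lemma soda_dl_abs_le (A B a : 'I_K) (l : 'I_K -> R) (e : R) :
  (forall a b, `|l a - l b| <= e) -> `|soda_dl A B l a| <= k * e.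
Proof.
move=> le; have k0 : 0 < k := natrB1_gt0 R K2.
rewrite /soda_dl !normrM (ger0_norm (ltW k0)) -mulrA ler_wpM2l ?(ltW k0) //.
rewrite -[leRHS]mul1r ler_pM // ?le //.
by case: (a == B); rewrite ?normr1 ?normr0.
Qed.

(** Both estimates are supported on the arm [B], so the indicators differ by at most 1 and the range
    is not doubled. *)
Lemma soda_dl_sub_abs_le (A B a b : 'I_K) (l : 'I_K -> R) (e : R) :
  (forall a b, `|l a - l b| <= e) ->
  `|soda_dl A B l a - soda_dl A B l b| <= k * e.
Proof.
move=> le; have k0 : 0 < k := natrB1_gt0 R K2.
rewrite /soda_dl -mulrBl -mulrBr !normrM (ger0_norm (ltW k0)) -mulrA.
rewrite ler_wpM2l ?(ltW k0) // -[leRHS]mul1r ler_pM // ?le //.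
by case: (a == B); case: (b == B);
  rewrite ?subrr ?subr0 ?sub0r ?normrN ?normr1 ?normr0.
Qed.

(** The importance weight cancels the probability of [B], and the excluded [B = A] would contribute
    0. In a difference of two arms [l A] drops out. *)
Lemma secondary_mean_dl (A a : 'I_K) (l : 'I_K -> R) :
  \sum_(B < K | B != A) k^-1 * soda_dl A B l a = l a - l A.
Proof.
have k0 : k != 0 by rewrite gt_eqF // natrB1_gt0.
transitivity (\sum_(B < K) (a == B)%:R * (l B - l A)).
  rewrite big_mkcond; apply: eq_bigr => B _.
  rewrite /soda_dl -!mulrA mulKf //.
  by case: eqP => [->|//]; rewrite subrr mulr0.
rewrite (bigD1 a) //= eqxx mul1r big1 ?addr0 // => B Ba.
by rewrite eq_sym (negbTE Ba) mul0r.
Qed.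

(** Second-order expansion of the exponential: the linear term is averaged exactly, the square is
    bounded by the range. *)
Lemma secondary_mean_exp_le (A a b : 'I_K) (l : 'I_K -> R) (e lam : R) :
  (forall a b, `|l a - l b| <= e) -> 0 <= lam -> lam * (k * e) <= 4^-1 ->
  \sum_(B < K | B != A)
     k^-1 * expR (- lam * (soda_dl A B l a - soda_dl A B l b)) <=
  1 - lam * (l a - l b) + lam ^+ 2 * (k ^+ 2 * e ^+ 2).
Proof.
move=> le lam0 lamk; have k0 : 0 < k := natrB1_gt0 R K2.
pose X B := soda_dl A B l a - soda_dl A B l b.
have -> : 1 - lam * (l a - l b) + lam ^+ 2 * (k ^+ 2 * e ^+ 2) =
    \sum_(B < K | B != A)
      k^-1 * ((1 + lam ^+ 2 * (k ^+ 2 * e ^+ 2)) - lam * X B).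
  under eq_bigr do rewrite mulrBr.
  rewrite big_split /= (secondary_mean_cst _ _ K2) addrAC; congr (_ + _).
  rewrite sumrN; congr (- _).
  under eq_bigr do rewrite mulrCA mulrBr.
  by rewrite -mulr_sumr sumrB !secondary_mean_dl; congr (_ * _); ring.
apply: ler_sum => B _; rewrite ler_wpM2l ?invr_ge0 ?(ltW k0) //.
have Xe : `|X B| <= k * e by exact: soda_dl_sub_abs_le.
apply: (le_trans (expR_le_quad _)).
  by rewrite mulNr normrN normrM (ger0_norm lam0) (le_trans _ lamk) // ler_wpM2l.
have : X B ^+ 2 <= k ^+ 2 * e ^+ 2.
  rewrite -exprMn -real_normK ?num_real //.
  by rewrite ler_sqr ?nnegrE // (le_trans _ Xe).
move/(ler_wpM2l (sqr_ge0 lam)).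
rewrite -/(X B); set x := X B; rewrite mulNr sqrrN exprMn; lra.
Qed.

(** The bound for the secondary arm is the same for every [A], so averaging over [A] affects only
    the suffered loss. *)
Lemma round_mean_exp_le (D S l : 'I_K -> R) (b : 'I_K) (Q : pred 'I_K)
    (e c : R) (w lam : 'I_K -> R) :
  (forall a b, `|l a - l b| <= e) ->
  (forall a, Q a -> [/\ 0 <= w a, 0 <= lam a & lam a * (k * e) <= 4^-1]) ->
  round_mean D S (fun A B => l A + (c + \sum_(a < K | Q a)
    w a * expR (- lam a * (soda_dl A B l a - soda_dl A B l b)))) <=
  \sum_(A < K) soda_p D S A * l A + (c + \sum_(a < K | Q a)
    w a * (1 - lam a * (l a - l b) + lam a ^+ 2 * (k ^+ 2 * e ^+ 2))).
Proof.
move=> le HQ; set C := (X in _ + X).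
have -> : \sum_(A < K) soda_p D S A * l A + C =
    \sum_(A < K) soda_p D S A * (l A + C).
  under [RHS]eq_bigr do rewrite mulrDr.
  by rewrite big_split /= -mulr_suml soda_p_sum ?mul1r // ltnW.
apply: ler_sum => A _; apply: ler_wpM2l; first exact: soda_p_ge0.
under eq_bigr do rewrite addrA mulrDr.
rewrite big_split /= (secondary_mean_cst _ _ K2) /C addrA lerD2l.
under eq_bigr do rewrite mulr_sumr.
rewrite exchange_big /=; apply: ler_sum => a Qa.
have [w0 lam0 lamk] := HQ a Qa.
under eq_bigr do rewrite mulrCA.
by rewrite -mulr_sumr ler_wpM2l // secondary_mean_exp_le.
Qed.

End exploration.

(** * Recursion over the rounds *)

Section regret.
Context {R : realType} {K : nat} {d : measure_display} {Omega : measurableType d}.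
Variables (P : probability Omega R) (ell : 'I_K -> Omega -> R) (b : 'I_K).
Hypothesis K2 : (2 <= K)%N.
Hypothesis ml : forall a, measurable_fun setT (ell a).
Hypothesis l01 : forall a w, 0 <= ell a w <= 1.
Hypothesis optb : forall a, mean P ell b <= mean P ell a.
Let eps := eff_range P ell.
Let Delta a := mean P ell a - mean P ell b.
Let V := (K%:R - 1) ^+ 2 * eps ^+ 2.

(** An invariant of the states after [t] rounds. At [t = 0] the bounds force [S] to vanish, so only
    [D] needs a separate clause. *)
Definition reachable (t : nat) (D S : 'I_K -> R) :=
  (forall a, 0 <= S a <= t%:R * V) /\ (t = 0 -> forall a, D a = 0).

Lemma reachable_upd (t : nat) (D S l : 'I_K -> R) (A B : 'I_K) :
  (forall a b, `|l a - l b| <= eps) -> reachable t D S ->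
  reachable t.+1 (soda_updD D A B l) (soda_updS S A B l).
Proof.
move=> le [HS _]; split=> // a; have /andP[S0 S1] := HS a.
rewrite /soda_updS addr_ge0 ?sqr_ge0 // -natr1 mulrDl mul1r lerD //.
have := soda_dl_abs_le K2 A B a le; set x := soda_dl _ _ _ _ => xe.
by rewrite /V -exprMn -real_normK ?num_real // ler_sqr ?nnegrE // (le_trans _ xe).
Qed.

(* By induction on the number [n] of remaining rounds: the regret of a play is
   [\sum_a Delta a * soda_p D S a], and each factor
   [expR (- lam a * (D a - D b))] is multiplied by at most [q a] in the mean
   when a round is played. *)
Lemma soda_loss_le (lam q : 'I_K -> R) (g psi : 'I_K -> nat -> R) (n t : nat)
    (D S : 'I_K -> R) :
  (forall a, 0 < Delta a -> 0 <= lam a /\ lam a * ((K%:R - 1) * eps) <= 4^-1) ->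
  (forall a, q a = 1 - lam a * Delta a + lam a ^+ 2 * V) ->
  (forall a, 0 < Delta a -> 0 <= q a) ->
  (forall a s, 0 <= psi a s) ->
  (forall s D S a, reachable s D S -> 0 < Delta a ->
    soda_p D S a <= g a s + psi a s * expR (- lam a * (D a - D b))) ->
  reachable t D S ->
  soda_loss P ell n D S <= n%:R * mean P ell b +
    \sum_(a < K | 0 < Delta a) Delta a *
      \sum_(i < n) (g a (t + i)%N +
        psi a (t + i)%N * expR (- lam a * (D a - D b)) * q a ^+ i).
Proof.
move=> Hlam Hq q0 psi0 Hp.
elim: n t D S => [|n IH] t D S HI.
  by rewrite /= mul0r add0r big1 // => a _; rewrite big_ord0 mulr0.
pose E a := expR (- lam a * (D a - D b)).
pose w a := Delta a * \sum_(i < n) psi a (t.+1 + i)%N * E a * q a ^+ i.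
pose c := n%:R * mean P ell b +
  \sum_(a < K | 0 < Delta a) Delta a * \sum_(i < n) g a (t.+1 + i)%N.
(* This bound is affine in [l], so its mean is its value at the vector of means, where the factor of
   [w a] becomes [q a]. *)
pose U (l : 'I_K -> R) := \sum_(A < K) soda_p D S A * l A +
  (c + \sum_(a < K | 0 < Delta a)
    w a * (1 - lam a * (l a - l b) + lam a ^+ 2 * V)).
have w0 a : 0 < Delta a -> 0 <= w a.
  move=> Da; rewrite mulr_ge0 ?(ltW Da) // sumr_ge0 // => i _.
  by rewrite !mulr_ge0 ?expR_ge0 ?exprn_ge0 ?q0.
have stepU l : (forall a b, `|l a - l b| <= eps) ->
    soda_round P ell n D S l <= U l.
  move=> le; apply: (le_trans _ (round_mean_exp_le K2 D S b c le _)); last first.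
    by move=> a Da; have [? ?] := Hlam a Da; split=> //; exact: w0.
  apply: le_round_mean => // A B _; rewrite lerD2l.
  apply: (le_trans (IH t.+1 _ _ (reachable_upd A B le HI))).
  rewrite /c -addrA lerD2l -big_split /= le_eqVlt; apply/orP; left; apply/eqP.
  apply: eq_bigr => a _; rewrite /w -mulrA -mulrDr; congr (_ * _).
  rewrite mulr_suml -big_split /=; apply: eq_bigr => i _; congr (_ + _).
  rewrite /soda_updD /E.
  rewrite (_ : - lam a * (D a + _ - _) = - lam a * (D a - D b) +
    - lam a * (soda_dl A B l a - soda_dl A B l b)); last by ring.
  by rewrite expRD; ring.
have [Ui UE] : has_mean P (fun w => U (ell ^~ w)) (U (mean P ell)).
  apply: has_meanD.
    by apply: has_mean_sum => A _; apply: has_meanZ; exact: has_mean_loss.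
  apply: has_meanD; first exact: has_mean_cst.
  apply: has_mean_sum => a _; apply: has_meanZ.
  apply: has_meanD; last exact: has_mean_cst.
  apply: has_meanD; first exact: has_mean_cst.
  rewrite -mulNr; under [X in has_mean _ X _]funext do rewrite -mulNr.
  apply: has_meanZ; apply: has_meanD; first exact: has_mean_loss.
  rewrite -mulN1r; under [X in has_mean _ X _]funext do rewrite -mulN1r.
  by apply: has_meanZ; exact: has_mean_loss.
apply: (le_trans (y := U (mean P ell))).
  rewrite -UE [soda_loss _ _ _ _ _]/(\int[P]_w soda_round P ell n D S (ell ^~ w)).
  apply: ae_le_Rintegral => //; first exact: soda_round_integrable.
  by apply: filterS (eff_range_ae P K2 l01) => x; exact: stepU.
rewrite /U.
have -> : \sum_(A < K) soda_p D S A * mean P ell A = mean P ell b +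
    \sum_(a < K | 0 < Delta a) Delta a * soda_p D S a.
  transitivity (\sum_(A < K) (soda_p D S A * mean P ell b + Delta A * soda_p D S A)).
    by apply: eq_bigr => A _; rewrite /Delta; ring.
  rewrite big_split /= -mulr_suml soda_p_sum ?mul1r ?(ltnW K2) //; congr (_ + _).
  rewrite [RHS]big_mkcond; apply: eq_bigr => a _.
  (* By optimality of [b], a gap that is not positive is zero. *)
  case: ltP => // Da; suff -> : Delta a = 0 by rewrite mul0r.
  by apply/le_anti; rewrite Da subr_ge0 optb.
rewrite /c -natr1 mulrDl mul1r [X in _ <= X + _]addrC -!addrA lerD2l.
rewrite addrCA lerD2l -!big_split /=; apply: ler_sum => a Da.
(* The term [i = 0] is the current round; in the later ones the new factor [q a] raises the exponent
   by one. *)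
rewrite big_ord_recl /= addn0 expr0 mulr1 -Hq /w -mulrA -!mulrDr.
rewrite ler_wpM2l ?(ltW Da) // lerD ?Hp // mulr_suml -big_split /=.
apply: ler_sum => i _; rewrite /bump /= add1n addnS addSn exprSr.
by rewrite -!mulrA.
Qed.

End regret.

(** * Summing the bounds for a single suboptimal arm *)

Section arm.
Context {R : realType} {K : nat}.
Variables (e Delta : R).
Hypothesis K2 : (2 <= K)%N.
Hypothesis De0 : 0 < Delta.
Hypothesis Dee : Delta <= e.
Notation k := (K%:R - 1 : R).
Let V := k ^+ 2 * e ^+ 2.

(* The minimizer in [lam] of [lam ^+ 2 * V - lam * Delta / 2], the exponent per
   round of the deviation bound. *)
Definition tilt := Delta / (4 * V).
(** The bound of [secondary_mean_exp_le] at the mean losses. *)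
Definition tilt_factor := 1 - tilt * Delta + tilt ^+ 2 * V.
(* In the first round ([t = 0]) SODA is uniform. *)
Definition gap_term (t : nat) : R :=
  if t is 0 then K%:R^-1 else
  K%:R * (expR (- (Num.sqrt (ln K%:R / (2 * V)) * (Delta / 2) * Num.sqrt t%:R))
          + expR (- (Delta / (4 * k) * t%:R))).
Definition tilt_weight (t : nat) : R :=
  if t is 0 then 0 else expR (tilt * (t%:R * Delta / 2)).

Lemma arm_range_gt0 : 0 < V.
Proof.
by rewrite mulr_gt0 ?exprn_gt0 ?(natrB1_gt0 R K2) // (lt_le_trans De0).
Qed.

Lemma tilt_ge0 : 0 <= tilt.
Proof. by rewrite ltW // divr_gt0 // mulr_gt0 // arm_range_gt0. Qed.

Lemma tilt_small : tilt * (k * e) <= 4^-1.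
Proof.
have k1 : 1 <= k by rewrite lerBrDl -[1 + 1]/(2%:R) ler_nat.
have k0 : 0 < k := natrB1_gt0 R K2.
have e0 : 0 < e := lt_le_trans De0 Dee.
have -> : tilt * (k * e) = Delta / (k * e) / 4.
  by rewrite /tilt /V; field; rewrite !gt_eqF.
rewrite ler_pdivrMr // mulVf // ler_pdivrMr ?mulr_gt0 // mul1r.
by rewrite (le_trans Dee) // ler_peMl // ltW.
Qed.

Lemma tilt_factor_ge0 : 0 <= tilt_factor.
Proof.
have k1 : 1 <= k by rewrite lerBrDl -[1 + 1]/(2%:R) ler_nat.
have e0 : 0 < e := lt_le_trans De0 Dee.
have : tilt * Delta <= 4^-1.
  apply: le_trans tilt_small; rewrite ler_wpM2l ?tilt_ge0 //.
  by rewrite (le_trans Dee) // ler_peMl // ltW.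
have : 0 <= tilt ^+ 2 * V by rewrite mulr_ge0 ?sqr_ge0 // ltW // arm_range_gt0.
rewrite /tilt_factor; lra.
Qed.

(** By [1 + x <= expR x], the exponent per round is at most [tilt ^+ 2 * V - tilt * Delta / 2],
    which is [- Delta ^+ 2 / (16 * V)]. *)
Lemma tilt_term_le (t : nat) :
  tilt_weight t.+1 * tilt_factor ^+ t.+1 <=
  expR (- (Delta ^+ 2 / (16 * V) * t.+1%:R)).
Proof.
have V0 := arm_range_gt0.
have qe : tilt_factor <= expR (- tilt * Delta + tilt ^+ 2 * V).
  apply: le_trans (expR_ge1Dx _); rewrite /tilt_factor; lra.
have -> : expR (- (Delta ^+ 2 / (16 * V) * t.+1%:R)) = tilt_weight t.+1 *
    expR (- tilt * Delta + tilt ^+ 2 * V) ^+ t.+1.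
  rewrite -expRM_natl -expRD; congr expR.
  by rewrite /tilt; field; rewrite gt_eqF.
rewrite ler_wpM2l ?expR_ge0 // ler_pXn2r // nnegrE ?expR_ge0 //.
exact: tilt_factor_ge0.
Qed.

Lemma arm_regret_le (n : nat) :
  Delta * \sum_(i < n) (gap_term i + tilt_weight i * tilt_factor ^+ i) <=
  ((16 * K%:R ^+ 3) / ln K%:R + 16 * K%:R ^+ 2) * (e ^+ 2 / Delta)
  + 4 * K%:R ^+ 2 + Delta / K%:R.
Proof.
have V0 := arm_range_gt0.
have k0 : 0 < k := natrB1_gt0 R K2.
have K0 : 0 < K%:R :> R by rewrite ltr0n ltnW.
have e0 : 0 < e := lt_le_trans De0 Dee.
have L0 : 0 < ln K%:R :> R by rewrite (lt_le_trans _ (ln_nat_ge_half R K2)).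
have kK : k <= K%:R by rewrite gerBl.
have VK : V <= K%:R ^+ 2 * e ^+ 2.
  by rewrite ler_wpM2r ?sqr_ge0 // ler_sqr ?nnegrE ?(ltW k0) ?(ltW K0).
pose c := Num.sqrt (ln K%:R / (2 * V)) * (Delta / 2).
have Q0 : 0 < ln K%:R / (2 * V) by rewrite divr_gt0 // mulr_gt0.
have c0 : 0 < c by rewrite mulr_gt0 ?divr_gt0 ?sqrtr_gt0.
have c2 : 2 / c ^+ 2 = 16 * V / (ln K%:R * Delta ^+ 2).
  by rewrite exprMn sqr_sqrtr ?ltW //; field; rewrite !gt_eqF.
(* The four terms come from the uniform first round, the series in [Num.sqrt t], and the geometric
   series of the capped rate and of the deviations. Multiplied by [Delta], they give the summands of
   the claim through [V <= K ^+ 2 * e ^+ 2] and [k <= K]. *)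
have main : \sum_(i < n) (gap_term i + tilt_weight i * tilt_factor ^+ i) <=
    K%:R^-1 + (K%:R * (16 * V / (ln K%:R * Delta ^+ 2) + 4 * k / Delta)
               + 16 * V / Delta ^+ 2).
  have rest0 : 0 <= K%:R * (16 * V / (ln K%:R * Delta ^+ 2) + 4 * k / Delta)
               + 16 * V / Delta ^+ 2.
    have D2 : 0 < Delta ^+ 2 by rewrite exprn_gt0.
    have A1 : 0 < 16 * V / (ln K%:R * Delta ^+ 2).
      by apply: divr_gt0; exact: mulr_gt0.
    have A2 : 0 < 4 * k / Delta by apply: divr_gt0 => //; exact: mulr_gt0.
    have A3 : 0 < 16 * V / Delta ^+ 2 by apply: divr_gt0 => //; exact: mulr_gt0.
    by apply/ltW/addr_gt0 => //; apply: mulr_gt0 => //; exact: addr_gt0.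
  case: n => [|n]; first by rewrite big_ord0 addr_ge0 ?invr_ge0 ?(ltW K0).
  rewrite big_ord_recl /= mul0r addr0 lerD2l big_split /= lerD //.
    rewrite -mulr_sumr ler_wpM2l ?(ltW K0) // big_split /= lerD //.
      by rewrite -c2; exact: sum_expRN_sqrt_le.
    rewrite (_ : 4 * k / Delta = (Delta / (4 * k))^-1); last first.
      by rewrite invfM invrK; field; rewrite !gt_eqF.
    by apply: sum_expRN_le; rewrite divr_gt0 ?mulr_gt0.
  apply: (le_trans (y := \sum_(i < n) expR (- (Delta ^+ 2 / (16 * V) * i.+1%:R)))).
    by apply: ler_sum => i _; exact: tilt_term_le.
  rewrite (_ : 16 * V / Delta ^+ 2 = (Delta ^+ 2 / (16 * V))^-1); last first.
    by field; rewrite !gt_eqF.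
  by apply: sum_expRN_le; rewrite divr_gt0 ?mulr_gt0 ?exprn_gt0.
apply: (le_trans (ler_wpM2l (ltW De0) main)).
have -> : Delta * (K%:R^-1 + (K%:R * (16 * V / (ln K%:R * Delta ^+ 2) +
    4 * k / Delta) + 16 * V / Delta ^+ 2)) =
    (16 * K%:R / ln K%:R + 16) * (V / Delta) + 4 * (K%:R * k) + Delta / K%:R.
  by field; rewrite !gt_eqF.
have -> : ((16 * K%:R ^+ 3) / ln K%:R + 16 * K%:R ^+ 2) * (e ^+ 2 / Delta) =
    (16 * K%:R / ln K%:R + 16) * (K%:R ^+ 2 * e ^+ 2 / Delta).
  by field; rewrite !gt_eqF.
rewrite lerD2r lerD //.
  rewrite ler_wpM2l //; last by rewrite ler_wpM2r ?invr_ge0 ?(ltW De0).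
  by rewrite addr_ge0 ?divr_ge0 ?mulr_ge0 ?(ltW K0) ?(ltW L0).
by rewrite ler_wpM2l // expr2 ler_wpM2l ?(ltW K0).
Qed.

End arm.

Theorem theorem3 (R : realType) (K : nat) (d : measure_display)
  (Omega : measurableType d) (P : probability Omega R)
  (ell : 'I_K -> Omega -> R) (astar : 'I_K) (T : nat) :
  (2 <= K)%N ->
  (forall a, measurable_fun setT (ell a)) ->
  (forall a w, 0 <= ell a w <= 1) ->
  (forall a, mean P ell astar <= mean P ell a) ->
  (1 <= T)%N ->
  let Delta := fun a => mean P ell a - mean P ell astar in
  let eps := eff_range P ell in
  soda_regret P ell T astar <=
  \sum_(a < K | 0 < Delta a)
     (((16 * K%:R ^+ 3) / ln (K%:R) + 16 * K%:R ^+ 2) * (eps ^+ 2 / Delta a)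
      + 4 * K%:R ^+ 2 + Delta a / K%:R).
Proof.
move=> K2 ml l01 opt _; cbv zeta.
set Delta := fun a => _ - _; set eps := eff_range P ell.
have De a : Delta a <= eps by exact: gap_le_eff_range.
(* The seed of the minimum is itself the optimal value, so it does not lower the minimum. *)
have minT : T%:R * mean P ell astar <=
    \big[Num.min/ (T%:R * mean P ell astar)]_(a < K) (T%:R * mean P ell a).
  by apply: le_bigmin => // a _; rewrite ler_wpM2l.
rewrite /soda_regret lerBlDl.
pose psi a := tilt_weight (K := K) eps (Delta a).
pose g a := gap_term (K := K) eps (Delta a).
have := @soda_loss_le _ _ _ _ P ell astar K2 ml l01 opt
  (fun a => tilt (K := K) eps (Delta a))
  (fun a => tilt_factor (K := K) eps (Delta a)) g psi T 0 (fun=> 0) (fun=> 0).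
move=> loss; apply: (le_trans (loss _ _ _ _ _ _)) => {loss} //.
- by move=> a Da; split; [exact: tilt_ge0|exact: tilt_small].
- by move=> a Da; exact: tilt_factor_ge0.
- by move=> a [|s]; rewrite ?expR_ge0.
- move=> [|s] D S a [HS HD] Da.
    rewrite /psi /g /= mul0r addr0 (soda_p0 (D := D) (S := S)) // => [|c].
      exact: HD.
    by apply/le_anti; rewrite andbC; have := HS c; rewrite mul0r.
  rewrite /psi /g /=; apply: soda_p_le => //; last exact: tilt_ge0.
  exact: lt_le_trans (De a).
- by split=> // a; rewrite mul0r lexx.
rewrite lerD //; apply: ler_sum => a Da.
(* Play starts from the zero state, where the exponential of [D a - D b] is 1. *)
under eq_bigr do rewrite subrr mulr0 expR0 mulr1.
exact: (arm_regret_le K2 Da (De a) T).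
Qed.
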